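(* Let $0<\frac1n\ll d\ll\mu\ll\alpha\ll\gamma,\epsilon\ll\delta\ll1$. Suppose $\mathcal{G}=\{G_1,\ldots,G_n\}$ is a collection of bipartite graphs on a common vertex partition $V=V_1\cup V_2$ with $|V_1|=|V_2|=n$ such that: $\mathcal{G}$ is $(\gamma,\alpha,\epsilon,\delta)$-stable; for every $i\in[n]$, $d_{G_i}(x)\geq(\frac12-\mu)n$ for all but at most $dn$ vertices $x\in V_1\cup V_2$; and for every $x\in V_1\cup V_2$, $d_{G_i}(x)\geq(\frac12-\mu)n$ for all but at most $dn$ colors $i\in[n]$. Then $\mathcal{G}$ contains a transversal perfect matching.
   Context: A transversal perfect matching in $\mathcal{G}=\{G_1,\dots,G_n\}$ is a perfect matching $M$ of $V_1\cup V_2$ together with a bijection $\phi:E(M)\to[n]$ with $e\in E(G_{\phi(e)})$ for all $e$. For a balanced bipartite graph $G$ on $V_1\cup V_2$ ($|V_i|=n$): $G$ is $\epsilon$-nice if for any $A\subseteq V_1$, $B\subseteq V_2$ of size at least $(\frac12-\epsilon)n$, $e_G(A,B)\ge\epsilon n^2$; $G$ is $\epsilon$-extremal if it is not $\epsilon^5$-nice. A characteristic partition of an $\epsilon$-extremal $G$ is a partition $(A_1,B_1,C_1,A_2,B_2,C_2)$ of $V$ with $A_i,B_i,C_i\subseteq V_i$, $|A_i|=|B_i|=(\frac12-\epsilon)n$, $|C_i|=2\epsilon n$, $d_G(v,X_i)\ge(\frac12-2\epsilon)n$ for all $v\in X_{3-i}$, $X\in\{A,B\}$, $i\in[2]$,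 and $e_G(A_1,B_2)\le\epsilon n^2$ or $e_G(A_2,B_1)\le\epsilon n^2$; for each $\epsilon$-extremal $G_\ell$ a characteristic partition $(A_1^\ell,B_1^\ell,C_1^\ell,A_2^\ell,B_2^\ell,C_2^\ell)$ is fixed. Two $\epsilon$-extremal $G_i,G_j$ are $\delta$-crossing if $|A_1^i\triangle A_1^j|\ge\delta n$ and $|A_1^i\triangle B_1^j|\ge\delta n$. The cross graph $C^{\epsilon,\delta}_{\mathcal{G}}$ has vertex set $[n]$, with $ij$ an edge iff $G_i,G_j$ are both $\epsilon$-extremal and $\delta$-crossing. $\mathcal{G}$ is $(\gamma,\alpha)$-strongly stable if $G_i$ is $\alpha$-nice for at least $\gamma n$ colors $i$; $(\epsilon,\delta)$-weakly stable if $e(C^{\epsilon,\delta}_{\mathcal{G}})\ge\delta n^2$; $(\gamma,\alpha,\epsilon,\delta)$-stable if it is either of these. The notation $\alpha\ll\beta$ means the statement holds whenever $\alpha\le f(\beta)$ for suitable $f$; hierarchies are read right to left. *)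

(* Defs.v *)
From mathcomp Require Import all_boot all_order all_algebra.
From mathcomp Require Import reals.
Set Implicit Arguments.
Unset Strict Implicit.
Unset Printing Implicit Defensive.

Import Order.TTheory GRing.Theory Num.Theory.
Local Open Scope ring_scope.

(* A bipartite graph with sides V1 and V2 is given by its edge set; its vertex
   set is the disjoint union V1 + V2.  In the balanced graphs considered here
   #|V1| = #|V2| = n, and #|V1| plays the role of n. *)
Definition bigraph (V1 V2 : finType) := {set V1 * V2}.

Definition edges_between (V1 V2 : finType) (G : bigraph V1 V2)
    (A : {set V1}) (B : {set V2}) : nat :=
  #|[set e in G | (e.1 \in A) && (e.2 \in B)]|.

Definition deg1 (V1 V2 : finType) (G : bigraph V1 V2)
    (u : V1) (Y : {set V2}) : nat := #|[set v in Y | (u, v) \in G]|.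

Definition deg2 (V1 V2 : finType) (G : bigraph V1 V2)
    (v : V2) (X : {set V1}) : nat := #|[set u in X | (u, v) \in G]|.

Definition deg (V1 V2 : finType) (G : bigraph V1 V2) (x : V1 + V2) : nat :=
  match x with
  | inl u => deg1 G u [set: V2]
  | inr v => deg2 G v [set: V1]
  end.

Definition nice (R : realType) (V1 V2 : finType) (eps : R)
    (G : bigraph V1 V2) : bool :=
  [forall A : {set V1}, forall B : {set V2},
    ((2^-1 - eps) * #|V1|%:R <= #|A|%:R) &&
    ((2^-1 - eps) * #|V1|%:R <= #|B|%:R) ==>
    (eps * #|V1|%:R ^+ 2 <= (edges_between G A B)%:R)].

Definition extremal (R : realType) (V1 V2 : finType) (eps : R)
    (G : bigraph V1 V2) : bool := ~~ nice (eps ^+ 5) G.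

Record sextuple (V1 V2 : finType) := Sextuple {
  A1 : {set V1}; B1 : {set V1}; C1 : {set V1};
  A2 : {set V2}; B2 : {set V2}; C2 : {set V2} }.

Definition tripartition (T : finType) (A B C : {set T}) : Prop :=
  [/\ A :|: B :|: C = [set: T], [disjoint A & B], [disjoint A & C]
    & [disjoint B & C]].

(* The prescribed size (1/2 - eps) n need not be an integer: the common size m
   of A1, B1, A2, B2 is allowed to be its floor or its ceiling.  The sets C1,
   C2 then have n - 2 m elements, that is 2 eps n when no rounding occurs. *)
Definition char_partition (R : realType) (V1 V2 : finType) (eps : R)
    (G : bigraph V1 V2) (P : sextuple V1 V2) : Prop :=
  [/\ tripartition (A1 P) (B1 P) (C1 P),
      tripartition (A2 P) (B2 P) (C2 P),
      exists2 m : nat, `|m%:R - (2^-1 - eps) * #|V1|%:R| < 1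
        & [/\ #|A1 P| = m, #|B1 P| = m, #|A2 P| = m & #|B2 P| = m],
      [/\ forall v, v \in A2 P ->
            (2^-1 - 2 * eps) * #|V1|%:R <= (deg2 G v (A1 P))%:R,
          forall v, v \in A1 P ->
            (2^-1 - 2 * eps) * #|V1|%:R <= (deg1 G v (A2 P))%:R,
          forall v, v \in B2 P ->
            (2^-1 - 2 * eps) * #|V1|%:R <= (deg2 G v (B1 P))%:R
        & forall v, v \in B1 P ->
            (2^-1 - 2 * eps) * #|V1|%:R <= (deg1 G v (B2 P))%:R]
    & (edges_between G (A1 P) (B2 P))%:R <= eps * #|V1|%:R ^+ 2 \/
      (edges_between G (B1 P) (A2 P))%:R <= eps * #|V1|%:R ^+ 2].

Definition symdiff (T : finType) (A B : {set T}) : {set T} :=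
  (A :\: B) :|: (B :\: A).

Definition crossing (R : realType) (V1 V2 : finType) (delta : R)
    (P Q : sextuple V1 V2) : bool :=
  (delta * #|V1|%:R <= #|symdiff (A1 P) (A1 Q)|%:R) &&
  (delta * #|V1|%:R <= #|symdiff (A1 P) (B1 Q)|%:R).

(* [crossing] is not exactly symmetric in its two partitions, so a pair of
   colours is an edge as soon as it is crossing in one of the two orders. *)
Definition cross_graph (R : realType) (n : nat) (V1 V2 : finType)
    (eps delta : R) (G : 'I_n -> bigraph V1 V2) (P : 'I_n -> sextuple V1 V2) :
    rel 'I_n :=
  fun i j => [&& i != j, extremal eps (G i), extremal eps (G j)
    & crossing delta (P i) (P j) || crossing delta (P j) (P i)].

Definition num_edges (n : nat) (C : rel 'I_n) : nat :=
  #|[set p : 'I_n * 'I_n | (p.1 < p.2)%N && C p.1 p.2]|.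

Definition strongly_stable (R : realType) (n : nat) (V1 V2 : finType)
    (gamma alpha : R) (G : 'I_n -> bigraph V1 V2) : Prop :=
  gamma * n%:R <= #|[set i | nice alpha (G i)]|%:R.

Definition weakly_stable (R : realType) (n : nat) (V1 V2 : finType)
    (eps delta : R) (G : 'I_n -> bigraph V1 V2) (P : 'I_n -> sextuple V1 V2) :
    Prop :=
  delta * n%:R ^+ 2 <= (num_edges (cross_graph eps delta G P))%:R.

Definition stable (R : realType) (n : nat) (V1 V2 : finType)
    (gamma alpha eps delta : R) (G : 'I_n -> bigraph V1 V2)
    (P : 'I_n -> sextuple V1 V2) : Prop :=
  strongly_stable gamma alpha G \/ weakly_stable eps delta G P.

Definition perfect_matching (V1 V2 : finType) (M : bigraph V1 V2) : Prop :=
  forall x : V1 + V2, deg M x = 1%N.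

Definition has_transversal_perfect_matching (n : nat) (V1 V2 : finType)
    (G : 'I_n -> bigraph V1 V2) : Prop :=
  exists (M : bigraph V1 V2) (phi : V1 * V2 -> 'I_n),
    [/\ perfect_matching M,
        {in M &, injective phi},
        phi @: M = [set: 'I_n]
      & forall e, e \in M -> e \in G (phi e)].

(* Main.v *)
(* View the collection as a 3-partite hypergraph whose edges are the triples
   [(u, v, c)] with [(u, v)] in [G c]; a transversal perfect matching is a
   perfect matching of it.  Both kinds of stability give the same consequence,
   [richness]: for every set [A] of about half of [V1], linearly many colours
   span quadratically many edges between [A] and every set of about half of
   [V2].  (In the weakly stable case the colours that fail for [A] have [A1]
   close to [A] or to its complement, so no two of them cross.)
   Richness yields cubically many single edges [(a, b, i)] absorbing a triple
   [(u, v, c)] through [(a, v, c)] and [(u, b, i)]; a derandomised choice gives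
   a small matching [F] with linearly many absorbers for every triple.
   A maximum matching containing [F] leaves only about [d n] vertices uncovered:
   otherwise its edges are used up by the disjoint neighbourhoods of uncovered
   vertices, one of these edges has a rich colour, and freeing that colour
   makes room for an augmentation.  The rest is absorbed by [F]. *)

Require Import Defs.
From mathcomp Require Import all_boot all_order all_algebra.
From mathcomp Require Import boolp reals.
From mathcomp Require Import zify ring lra.
Set Implicit Arguments.
Unset Strict Implicit.
Unset Printing Implicit Defensive.

Import Order.TTheory GRing.Theory Num.Theory.
Local Open Scope ring_scope.

(** * Matchings of triples and their local modifications *)

Lemma imset_setD1 (T T' : finType) (h : T -> T') (M : {set T}) (e : T) :
  e \in M -> {in M &, injective h} -> h @: (M :\ e) = (h @: M) :\ h e.
Proof.
move=> eM hI; apply/setP => y; rewrite !inE; apply/imsetP/andP.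
  move=> [f]; rewrite !inE => /andP[fe fM] ->; split; last exact: imset_f.
  by apply: contra fe => /eqP /(hI _ _ fM eM) ->.
move=> [yh /imsetP[f fM yE]]; exists f => //; rewrite !inE fM andbT.
by apply: contra yh => /eqP <-; rewrite yE.
Qed.

Section Matchings.
Variables V1 V2 C : finType.
Implicit Types (G : C -> bigraph V1 V2) (M N F : {set V1 * V2 * C}).

Definition cov1 M := [set e.1.1 | e in M].
Definition cov2 M := [set e.1.2 | e in M].
Definition cov3 M := [set e.2 | e in M].

Definition matching G M : Prop :=
  [/\ forall e, e \in M -> e.1 \in G e.2,
      {in M &, injective (fun e => e.1.1)},
      {in M &, injective (fun e => e.1.2)}
    & {in M &, injective snd}].

Definition fits M (f : V1 * V2 * C) : bool :=
  [&& f.1.1 \notin cov1 M, f.1.2 \notin cov2 M & f.2 \notin cov3 M].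

Lemma matchingS G M N : N \subset M -> matching G M -> matching G N.
Proof.
move=> /subsetP NM [ME I1 I2 I3].
by split=> [e /NM /ME //|e f /NM eM /NM fM|e f /NM eM /NM fM|e f /NM eM /NM fM];
  [apply: I1|apply: I2|apply: I3].
Qed.

Lemma matchingU1 G M f :
  matching G M -> f.1 \in G f.2 -> fits M f -> matching G (f |: M).
Proof.
move=> [ME I1 I2 I3] fG /and3P[f1 f2 f3]; split.
- by move=> e; rewrite !inE => /orP[/eqP ->|/ME].
- move=> e e'; rewrite !inE => /orP[/eqP ->|eM] /orP[/eqP -> //|e'M] /=.
  + by move=> E; case/negP: f1; rewrite E; apply/imsetP; exists e'.
  + by move=> E; case/negP: f1; rewrite -E; apply/imsetP; exists e.
  + exact: I1.
- move=> e e'; rewrite !inE => /orP[/eqP ->|eM] /orP[/eqP -> //|e'M] /=.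
  + by move=> E; case/negP: f2; rewrite E; apply/imsetP; exists e'.
  + by move=> E; case/negP: f2; rewrite -E; apply/imsetP; exists e.
  + exact: I2.
- move=> e e'; rewrite !inE => /orP[/eqP ->|eM] /orP[/eqP -> //|e'M] /=.
  + by move=> E; case/negP: f3; rewrite E; apply/imsetP; exists e'.
  + by move=> E; case/negP: f3; rewrite -E; apply/imsetP; exists e.
  + exact: I3.
Qed.

Lemma fits_notin M f : fits M f -> f \notin M.
Proof. by case/and3P=> + _ _; apply: contra => ?; apply: imset_f. Qed.

Lemma cov1U M f : cov1 (f |: M) = f.1.1 |: cov1 M. Proof. exact: imsetU1. Qed.
Lemma cov2U M f : cov2 (f |: M) = f.1.2 |: cov2 M. Proof. exact: imsetU1. Qed.
Lemma cov3U M f : cov3 (f |: M) = f.2 |: cov3 M. Proof. exact: imsetU1. Qed.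

Lemma cov1D G M e :
  matching G M -> e \in M -> cov1 (M :\ e) = cov1 M :\ e.1.1.
Proof. by move=> [_ I _ _] eM; apply: (imset_setD1 eM). Qed.

Lemma cov2D G M e :
  matching G M -> e \in M -> cov2 (M :\ e) = cov2 M :\ e.1.2.
Proof. by move=> [_ _ I _] eM; apply: (imset_setD1 eM). Qed.

Lemma cov3D G M e :
  matching G M -> e \in M -> cov3 (M :\ e) = cov3 M :\ e.2.
Proof. by move=> [_ _ _ I] eM; apply: (imset_setD1 eM). Qed.

Lemma card_cov1 G M : matching G M -> #|cov1 M| = #|M|.
Proof. by move=> [_ I _ _]; apply: card_in_imset. Qed.

Lemma card_cov2 G M : matching G M -> #|cov2 M| = #|M|.
Proof. by move=> [_ _ I _]; apply: card_in_imset. Qed.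

Lemma card_cov3 G M : matching G M -> #|cov3 M| = #|M|.
Proof. by move=> [_ _ _ I]; apply: card_in_imset. Qed.

(** * Maximum matchings and their exchanges *)

(** Maximality is relative to the matchings containing [F], the reserved absorbers. The exchanges
    that exploit it remove only edges of [M :\: F]. *)
Definition max_matching G F M : Prop :=
  [/\ matching G M, F \subset M
    & forall N, matching G N -> F \subset N -> (#|N| <= #|M|)%N].

Lemma exists_max_matching G F : matching G F -> exists M, max_matching G F M.
Proof.
move=> mF.
suff H k : forall M, matching G M -> F \subset M ->
    (#|[set: V1 * V2 * C]| - #|M| < k)%N -> exists M, max_matching G F M.
  exact: (H _ F mF (subxx _) (ltnSn _)).
elim: k => // k IH M mM FM Mk.
have [[N [mN FN MN]]|nN] := pselect
    (exists N, [/\ matching G N, F \subset N & (#|M| < #|N|)%N]).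
  apply: (IH N mN FN); have := subset_leq_card (subsetT N); lia.
exists M; split=> // N mN FN; rewrite leqNgt; apply/negP => MN.
by apply: nN; exists N.
Qed.

(** A swap keeps both the size and [F], so maximality transfers. This permits changing which
    vertices and colours are uncovered. *)
Lemma max_matching_swap G F M e f :
  max_matching G F M -> e \in M :\: F -> f.1 \in G f.2 -> fits (M :\ e) f ->
  max_matching G F (f |: M :\ e).
Proof.
move=> [mM FM maxM]; rewrite inE => /andP[eF eM] fG ff; split.
- by apply: matchingU1 => //; apply: matchingS mM; apply: subD1set.
- apply/subsetP => x xF; rewrite !inE (subsetP FM) // andbT.
  by apply/orP; right; apply: contraNneq eF => <-.
- move=> N mN FN; apply: leq_trans (maxM N mN FN) _.
  by rewrite cardsU1 fits_notin // (cardsD1 e M) eM.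
Qed.

(** The edge [e] could be replaced by [(e.1.1, v, c')] and [(u, e.1.2, c)], a gain of one edge. *)
Lemma max_matching_rotate G F M e u v c c' :
  max_matching G F M -> e \in M :\: F ->
  u \notin cov1 M -> v \notin cov2 M -> c \notin cov3 M -> c' \notin cov3 M ->
  c != c' -> (u, e.1.2) \in G c -> (e.1.1, v) \in G c' -> False.
Proof.
move=> [mM FM maxM]; rewrite inE => /andP[eF eM] uM vM cM c'M cc' ub av.
have mMe : matching G (M :\ e) by apply: matchingS mM; apply: subD1set.
set f : V1 * V2 * C := (e.1.1, v, c').
set f' : V1 * V2 * C := (u, e.1.2, c).
have ff : fits (M :\ e) f.
  rewrite /fits (cov1D mM eM) (cov2D mM eM) (cov3D mM eM) !inE /= eqxx /=.
  by rewrite (negbTE vM) (negbTE c'M) !andbF.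
have ff' : fits (f |: M :\ e) f'.
  rewrite /fits cov1U cov2U cov3U (cov1D mM eM) (cov2D mM eM) (cov3D mM eM).
  rewrite !inE /= eqxx /= (negbTE uM) (negbTE cM) (negbTE cc') !andbF !orbF.
  rewrite andbT; apply/andP; split.
    by apply: contraNneq uM => ->; apply/imsetP; exists e.
  by apply: contraNneq vM => <-; apply/imsetP; exists e.
have mN : matching G (f' |: (f |: M :\ e)) by do 2!apply: matchingU1 => //.
have FN : F \subset f' |: (f |: M :\ e).
  apply/subsetP => x xF; rewrite !inE (subsetP FM) // andbT.
  by rewrite (_ : x != e) ?orbT //; apply: contraNneq eF => <-.
have := maxM _ mN FN.
by rewrite cardsU1 (fits_notin ff') cardsU1 (fits_notin ff) (cardsD1 e M) eM !add1n ltnn.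
Qed.

(** Two edges would become three: [(u, e.1.2, c)] replaces [e] and uncovers [e.1.1]; then [e'] is
    rotated into [(e.1.1, e'.1.2, j)] and [(e'.1.1, v, c')]. *)
Lemma max_matching_no_edge G F M e e' u v c c' j :
  max_matching G F M -> e \in M :\: F -> e' \in M :\: F ->
  u \notin cov1 M -> v \notin cov2 M ->
  c \notin cov3 M -> c' \notin cov3 M -> j \notin cov3 M ->
  c != c' -> c != j -> c' != j ->
  (u, e.1.2) \in G c -> (e'.1.1, v) \in G c' -> (e.1.1, e'.1.2) \notin G j.
Proof.
move=> maxM eM e'M uM vM cM c'M jM cc' cj c'j ub av; apply/negP => ab.
(* If the edges coincide, one rotation already contradicts maximality, without colour [j]. *)
have [ee'|ee'] := eqVneq e e'.
  by subst e'; apply: (max_matching_rotate maxM eM uM vM cM c'M).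
have [mM _ _] := maxM; have [_ I1 I2 I3] := mM.
have [eM0 eF] := setDP eM; have [e'M0 e'F] := setDP e'M.
set f : V1 * V2 * C := (u, e.1.2, c).
have ff : fits (M :\ e) f.
  rewrite /fits (cov1D mM eM0) (cov2D mM eM0) (cov3D mM eM0) !inE /= eqxx /=.
  by rewrite (negbTE uM) (negbTE cM) !andbF.
have maxM' : max_matching G F (f |: M :\ e) by apply: max_matching_swap.
apply: (@max_matching_rotate _ _ _ e' e.1.1 v j c' maxM') => //.
- by rewrite !inE [e' == e]eq_sym ee' e'F e'M0 orbT.
- rewrite cov1U (cov1D mM eM0) !inE eqxx orbF.
  by apply: contraNneq uM => E; rewrite -[u]/f.1.1 -E; apply/imsetP; exists e.
- rewrite cov2U (cov2D mM eM0) !inE (negbTE vM) andbF orbF.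
  by apply: contraNneq vM => ->; apply/imsetP; exists e.
- by rewrite cov3U (cov3D mM eM0) !inE (negbTE jM) andbF orbF eq_sym.
- by rewrite cov3U (cov3D mM eM0) !inE (negbTE c'M) andbF orbF eq_sym.
- by rewrite eq_sym.
Qed.

(* The edge [f] replaces [e0], which frees the colour of [e0]. *)
Lemma max_matching_no_edge_swap G F M e0 f e e' u v c c' :
  max_matching G F M -> e0 \in M :\: F ->
  f.1 \in G f.2 -> fits (M :\ e0) f ->
  f.1.1 != u -> f.1.2 != v -> f.2 != c -> f.2 != c' -> f.2 != e0.2 ->
  u \notin cov1 M -> v \notin cov2 M -> c \notin cov3 M -> c' \notin cov3 M ->
  c != c' -> e \in M :\: F -> e' \in M :\: F -> e != e0 -> e' != e0 ->
  (u, e.1.2) \in G c -> (e'.1.1, v) \in G c' -> (e.1.1, e'.1.2) \notin G e0.2.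
Proof.
move=> maxM e0M fG ff fu fv fc fc' fe0 uM vM cM c'M cc' eM e'M ee0 e'e0.
have [mM _ _] := maxM.
have [e0M0 e0F] := setDP e0M.
have [eM0 eF] := setDP eM; have [e'M0 e'F] := setDP e'M.
have j3 : e0.2 \in cov3 M by apply/imsetP; exists e0.
apply: (max_matching_no_edge (max_matching_swap maxM e0M fG ff)).
- by rewrite !inE ee0 eM0 eF orbT.
- by rewrite !inE e'e0 e'M0 e'F orbT.
- by rewrite cov1U (cov1D mM e0M0) !inE (negbTE uM) andbF orbF eq_sym.
- by rewrite cov2U (cov2D mM e0M0) !inE (negbTE vM) andbF orbF eq_sym.
- by rewrite cov3U (cov3D mM e0M0) !inE (negbTE cM) andbF orbF eq_sym.
- by rewrite cov3U (cov3D mM e0M0) !inE (negbTE c'M) andbF orbF eq_sym.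
- by rewrite cov3U (cov3D mM e0M0) !inE eqxx /= orbF eq_sym.
- by [].
- by apply: contraNneq cM => ->.
- by apply: contraNneq c'M => ->.
Qed.

(** * Absorbing the uncovered vertices and colours *)

(** Such an edge can take [v] in place of its second vertex, releasing a vertex that is good for
    [c]. The abstract [good] will be large degree in the colour. *)
Definition exchangeable G (good : V2 -> C -> bool) (v : V2) (c : C) :=
  [set e : V1 * V2 * C | ((e.1.1, v) \in G e.2) && good e.1.2 c].

(** An edge [(a, b', i)] of this set absorbs [(u, b, c)]: it is replaced by [(a, b, c)] and
    [(u, b', i)]. *)
Definition absorbing G (u : V1) (b : V2) (c : C) :=
  [set e : V1 * V2 * C | ((e.1.1, b) \in G c) && ((u, e.1.2) \in G e.2)].

(* The exchange with [e] replaces the uncovered [v] by [e.1.2], which has large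
   degree in colour [c] even if [v] does not; [e'] then absorbs. *)
Lemma matching_absorb G M e e' u v c :
  matching G M -> e \in M -> e' \in M -> e != e' ->
  u \notin cov1 M -> v \notin cov2 M -> c \notin cov3 M ->
  (e.1.1, v) \in G e.2 -> (e'.1.1, e.1.2) \in G c -> (u, e'.1.2) \in G e'.2 ->
  exists N, [/\ matching G N, #|N| = #|M|.+1 & M :\ e :\ e' \subset N].
Proof.
move=> mM eM e'M ee' uM vM cM av a'b ub'.
have mMe : matching G (M :\ e) by apply: matchingS mM; apply: subD1set.
have e'Me : e' \in M :\ e by rewrite !inE eq_sym ee'.
have mMe' : matching G (M :\ e :\ e').
  by apply: matchingS mMe; apply: subD1set.
have [_ I1 I2 I3] := mM.
set f : V1 * V2 * C := (e.1.1, v, e.2).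
set g : V1 * V2 * C := (e'.1.1, e.1.2, c).
set h : V1 * V2 * C := (u, e'.1.2, e'.2).
have n1 : e.1.1 != e'.1.1 by apply: contraNneq ee' => E; apply/eqP/I1.
have n2 : e.1.2 != e'.1.2 by apply: contraNneq ee' => E; apply/eqP/I2.
have n3 : e.2 != e'.2 by apply: contraNneq ee' => E; apply/eqP/I3.
have k1 x : x \in M -> x.1.1 != u.
  by move=> xM; apply: contraNneq uM => <-; apply/imsetP; exists x.
have k2 x : x \in M -> x.1.2 != v.
  by move=> xM; apply: contraNneq vM => <-; apply/imsetP; exists x.
have k3 x : x \in M -> x.2 != c.
  by move=> xM; apply: contraNneq cM => <-; apply/imsetP; exists x.
have D1 := (cov1D mMe e'Me, cov1D mM eM).
have D2 := (cov2D mMe e'Me, cov2D mM eM).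
have D3 := (cov3D mMe e'Me, cov3D mM eM).
have ff : fits (M :\ e :\ e') f.
  by rewrite /fits !D1 !D2 !D3 !inE /= !eqxx /= (negbTE vM) !andbF.
have gf : fits (f |: M :\ e :\ e') g.
  rewrite /fits cov1U cov2U cov3U !D1 !D2 !D3 !inE /= !eqxx /= (negbTE cM) !andbF.
  by rewrite !orbF eq_sym n1 k2 // eq_sym k3.
have hf : fits (g |: (f |: M :\ e :\ e')) h.
  rewrite /fits !(cov1U, cov2U, cov3U) !D1 !D2 !D3 !inE /= !eqxx /= (negbTE uM).
  rewrite !andbF !orbF !negb_or !(eq_sym u) !k1 //= (k2 e') // (k3 e') //.
  by rewrite eq_sym n2 eq_sym n3.
exists (h |: (g |: (f |: M :\ e :\ e'))); split.
- by do 3!apply: matchingU1 => //.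
- rewrite cardsU1 (fits_notin hf) cardsU1 (fits_notin gf).
  by rewrite cardsU1 (fits_notin ff) (cardsD1 e M) eM (cardsD1 e' (M :\ e)) e'Me.
- by apply/subsetP => x xM; rewrite !in_setU1 xM !orbT.
Qed.

Lemma notin_ex (T : finType) (A : {set T}) :
  (#|A| < #|T|)%N -> exists x, x \notin A.
Proof.
move=> AT; have : (0 < #|~: A|)%N by rewrite cardsCs setCK subn_gt0.
by case/card_gt0P => x; rewrite inE; exists x.
Qed.

Lemma double_leqS (b b' : bool) (k x : nat) :
  (2 * k.+1 <= b + (b' + x) -> 2 * k <= x)%N.
Proof. by case: b; case: b'; lia. Qed.

Lemma double_gt0 (b : bool) (k x : nat) : (2 * k.+1 <= b + x -> 0 < x)%N.
Proof. by case: b; lia. Qed.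

(** Induction on the number [k] of missing edges. One absorption consumes two edges of [F], so each
    requirement loses at most two hits and [2 * k] hits suffice. *)
Lemma matching_absorb_all G (good : V2 -> C -> bool) k M F :
  #|V2| = #|V1| -> #|C| = #|V1| ->
  matching G M -> (#|M| + k)%N = #|V1| -> F \subset M ->
  (forall v c, (2 * k <= #|F :&: exchangeable G good v c|)%N) ->
  (forall u b c, good b c -> (2 * k <= #|F :&: absorbing G u b c|)%N) ->
  exists N, matching G N /\ #|N| = #|V1|.
Proof.
move=> n2 n3; elim: k M F => [|k IH] M F mM Mk FM HE HA.
  by exists M; split; rewrite // -Mk addn0.
have [u uM] : exists u, u \notin cov1 M.
  by apply: notin_ex; rewrite (card_cov1 mM); lia.
have [v vM] : exists v, v \notin cov2 M.
  by apply: notin_ex; rewrite (card_cov2 mM); lia.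
have [c cM] : exists c, c \notin cov3 M.
  by apply: notin_ex; rewrite (card_cov3 mM); lia.
have /card_gt0P[e] : (0 < #|F :&: exchangeable G good v c|)%N.
  by apply: leq_trans (HE v c).
rewrite !inE => /and3P[eF av gbc].
(* At least two hits are available, so one remains when [e] is excluded. *)
have /card_gt0P[e'] : (0 < #|(F :&: absorbing G u e.1.2 c) :\ e|)%N.
  have := HA u _ _ gbc; rewrite (cardsD1 e).
  exact: double_gt0.
rewrite !inE => /and4P[e'e e'F a'b ub'].
have ee' : e != e' by rewrite eq_sym.
have [N [mN cN MN]] := matching_absorb mM (subsetP FM _ eF) (subsetP FM _ e'F)
  ee' uM vM cM av a'b ub'.
have H (Q : {set V1 * V2 * C}) : (2 * k.+1 <= #|F :&: Q|)%N ->
    (2 * k <= #|(F :\ e :\ e') :&: Q|)%N.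
  have -> : (F :\ e :\ e') :&: Q = (F :&: Q) :\ e :\ e'.
    by apply/setP => x; rewrite !inE; do !case: (_ == _); do !case: (_ \in _).
  rewrite (cardsD1 e (F :&: Q)) (cardsD1 e' (_ :\ _)).
  exact: double_leqS.
apply: (IH N (F :\ e :\ e')) => //.
- by rewrite cN addSnnS.
- apply: subset_trans MN; apply/subsetP => x; rewrite !inE.
  by case/and3P=> -> -> /(subsetP FM) ->.
- by move=> v' c'; apply: H.
- by move=> u' b' c' g; apply: H; apply: HA.
Qed.
End Matchings.

(** * From matchings of triples to transversal matchings *)

Lemma has_transversal_perfect_matchingP (n : nat) (V1 V2 : finType)
    (G : 'I_n -> bigraph V1 V2) M :
  (0 < n)%N -> #|V1| = n -> #|V2| = n -> matching G M -> #|M| = n ->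
  has_transversal_perfect_matching G.
Proof.
case: n G M => // n G M _ n1 n2 mM cM.
have [ME I1 I2 I3] := mM.
have c1 : cov1 M = setT.
  by apply/eqP; rewrite eqEcard subsetT cardsT n1 (card_cov1 mM) cM /=.
have c2 : cov2 M = setT.
  by apply/eqP; rewrite eqEcard subsetT cardsT n2 (card_cov2 mM) cM /=.
have c3 : cov3 M = setT.
  by apply/eqP; rewrite eqEcard subsetT cardsT card_ord (card_cov3 mM) cM /=.
(* The value [ord0] is a default for pairs outside the matching; it exists because [n] was replaced
   by a successor. *)
pose phi (p : V1 * V2) : 'I_n.+1 :=
  if [pick e in M | e.1 == p] is Some e then e.2 else ord0.
have phiE e : e \in M -> phi e.1 = e.2.
  move=> eM; rewrite /phi; case: pickP => [f /andP[fM /eqP fe]|/(_ e)].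
    by congr snd; apply: I1; rewrite //= fe.
  by rewrite eM eqxx.
exists [set e.1 | e in M], phi; split.
- case=> [u|v] /=.
    have : u \in cov1 M by rewrite c1.
    case/imsetP => e eM ->; rewrite /deg1; apply/eqP/cards1P; exists e.1.2.
    apply/setP => v; rewrite !inE /=; apply/imsetP/eqP => [[f fM ue]|->].
      suff -> : e = f by rewrite -ue.
      by apply: I1; rewrite //= -ue.
    by exists e; rewrite // -surjective_pairing.
  have : v \in cov2 M by rewrite c2.
  case/imsetP => e eM ->; rewrite /deg2; apply/eqP/cards1P; exists e.1.1.
  apply/setP => u; rewrite !inE /=; apply/imsetP/eqP => [[f fM ue]|->].
    suff -> : e = f by rewrite -ue.
    by apply: I2; rewrite //= -ue.
  by exists e; rewrite // -surjective_pairing.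
- move=> _ _ /imsetP[e eM ->] /imsetP[f fM ->]; rewrite !phiE //.
  by move=> /(I3 _ _ eM fM) ->.
- apply/setP => i; rewrite inE; apply/imsetP.
  have : i \in cov3 M by rewrite c3.
  case/imsetP => e eM ->; exists e.1; first exact: imset_f.
  by rewrite phiE.
- by move=> _ /imsetP[e eM ->]; rewrite phiE // ME.
Qed.

(** * Choosing the absorbers *)

Section Greedy.
Variables (R : realFieldType) (V1 V2 C T : finType) (n : nat).
Variables (G : C -> bigraph V1 V2) (D : {set T}) (Q : T -> {set V1 * V2 * C}).
Variable th : R.
Hypotheses (n1 : #|V1| = n) (n2 : #|V2| = n) (n3 : #|C| = n) (n_gt0 : (0 < n)%N).
Hypothesis th_gt0 : 0 < th.
Hypothesis QG : forall t e, t \in D -> e \in Q t -> e.1 \in G e.2.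
Hypothesis Q_ge : forall t, t \in D -> th * n%:R ^+ 3 <= #|Q t|%:R.

(** Adding to [F] a new edge of [Q t] halves the term of [t], so a small total forces every
    requirement to be hit often. *)
Definition potential (F : {set V1 * V2 * C}) : R :=
  \sum_(t in D) 2^-1 ^+ #|F :&: Q t|.

(** A triple that does not fit shares a coordinate with [F]; each of the three coordinates accounts
    for at most [#|F| * n ^ 2] triples. *)
Lemma card_not_fits (F : {set V1 * V2 * C}) :
  matching G F -> (#|[set e | ~~ fits F e]| <= 3 * #|F| * n ^ 2)%N.
Proof.
move=> mF.
pose S1 := setX (setX (cov1 F) [set: V2]) [set: C].
pose S2 := setX (setX [set: V1] (cov2 F)) [set: C].
pose S3 := setX (setX [set: V1] [set: V2]) (cov3 F).
have sub : [set e | ~~ fits F e] \subset S1 :|: S2 :|: S3.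
  by apply/subsetP => e; rewrite !inE !andbT /= /fits !negb_and !negbK orbA.
apply: leq_trans (subset_leq_card sub) _.
apply: leq_trans (leq_card_setU _ _) _.
apply: leq_trans (leq_add (leq_card_setU _ _) (leqnn _)) _.
rewrite !cardsX !cardsT (card_cov1 mF) (card_cov2 mF) (card_cov3 mF) n1 n2 n3.
by apply: eq_leq; ring.
Qed.

(** Averaging over the at most [n ^ 3] edges that can be added: each [Q t] keeps half of its edges,
    so the total decrease is at least [th * n ^ 3 / 4] times the potential, and some edge achieves
    the fraction [th / 8]. *)
Lemma potential_step (F : {set V1 * V2 * C}) :
  matching G F -> 6 * #|F|%:R <= th * n%:R ->
  exists F', [/\ matching G F', (#|F'| <= #|F|.+1)%N
    & potential F' <= (1 - th / 8) * potential F].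
Proof.
move=> mF Fm.
(* In the degenerate case, for instance when [D] is empty, [F] itself works; afterwards the
   potential is positive. *)
have [P0|P0] := leP (potential F) 0.
  exists F; split=> //.
  have : 0 <= th * - potential F by apply: mulr_ge0; [exact: ltW|rewrite oppr_ge0].
  lra.
pose av := [set e : V1 * V2 * C | fits F e && (e.1 \in G e.2)].
pose w t : R := 2^-1 ^+ #|F :&: Q t|.
have w_gt0 t : 0 < w t by apply: exprn_gt0; lra.
have [/existsP[e /andP[eav eP]]|] := boolP
    [exists e, (e \in av) && (potential (e |: F) <= (1 - th / 8) * potential F)].
  move: eav; rewrite inE => /andP[ef eG]; exists (e |: F); split=> //.
    exact: matchingU1.
  by rewrite cardsU1 fits_notin.
rewrite negb_exists => /forallP noe; exfalso.
have wU e t : e \in av ->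
    2^-1 ^+ #|(e |: F) :&: Q t| = w t * (1 - (e \in Q t)%:R / 2).
  rewrite inE => /andP[/fits_notin eF _]; rewrite setIUl /w.
  have [eQ|eQ] := boolP (e \in Q t).
    have -> : [set e] :&: Q t = [set e] by apply/setIidPl; rewrite sub1set.
    by rewrite cardsU1 inE (negbTE eF) /= exprS; field.
  have -> : [set e] :&: Q t = set0.
    by apply/setP => x; rewrite !inE; case: eqP => // ->; rewrite (negbTE eQ).
  by rewrite set0U mul0r subr0 mulr1.
(* By the size bound on [F], the edges that do not fit number at most [3 * #|F| * n ^ 2], which is
   at most [th * n ^ 3 / 2]. *)
have Qav t : t \in D -> th * n%:R ^+ 3 / 2 <= \sum_(e in av) (e \in Q t)%:R.
  move=> tD; rewrite -natr_sum.
  have -> : (\sum_(e in av) (e \in Q t) = #|av :&: Q t|)%N.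
    rewrite -sum1_card big_mkcond [RHS]big_mkcond.
    by apply: eq_bigr => e _; rewrite in_setI; case: (e \in av); case: (e \in Q t).
  have sub : Q t \subset (av :&: Q t) :|: [set e | ~~ fits F e].
    apply/subsetP => e eQ; rewrite !inE eQ (QG tD eQ) !andbT.
    by case: (fits F e).
  have := leq_trans (subset_leq_card sub) (leq_card_setU _ _).
  move=> /leq_trans/(_ (leq_add (leqnn _) (card_not_fits mF))).
  rewrite -(ler_nat R) natrD !natrM => H.
  have nn : 0 < n%:R :> R by rewrite ltr0n.
  have := Q_ge tD; rewrite exprS expr2 => H1.
  have : 0 <= (th * n%:R - 6 * #|F|%:R) * (n%:R * n%:R).
    by apply: mulr_ge0; [rewrite subr_ge0|apply: mulr_ge0; exact: ltW].
  lra.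
(* Double counting of the total decrease, by edges and by requirements. *)
have S : \sum_(e in av) (potential F - potential (e |: F)) =
    \sum_(t in D) w t / 2 * \sum_(e in av) (e \in Q t)%:R.
  under [RHS]eq_bigr do rewrite mulr_sumr.
  rewrite exchange_big /=; apply: eq_bigr => e eav.
  rewrite -sumrB; apply: eq_bigr => t _; rewrite (wU _ _ eav) -/(w t); ring.
have L : potential F * (th * n%:R ^+ 3 / 4) <=
    \sum_(e in av) (potential F - potential (e |: F)).
  rewrite S mulr_suml; apply: ler_sum => t tD.
  rewrite -[2^-1 ^+ _]/(w t).
  rewrite (_ : _ * _ = w t / 2 * (th * n%:R ^+ 3 / 2)); last by field.
  by apply: ler_wpM2l (Qav t tD); rewrite divr_ge0 ?ltW.
(* If no edge is suitable, each decrease is below the fraction [th / 8], against the average of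
   [th / 4] given by [L]. *)
have U : \sum_(e in av) (potential F - potential (e |: F)) <=
    #|av|%:R * (th / 8 * potential F).
  rewrite mulr_natl -sumr_const; apply: ler_sum => e eav.
  have := noe e; rewrite eav /= -ltNge => H; lra.
have avn : #|av|%:R <= n%:R ^+ 3 :> R.
  rewrite -natrX ler_nat; apply: leq_trans (max_card _) _.
  by rewrite !card_prod n1 n2 n3 !expnS expn0 muln1 mulnA.
have n3p : 0 < n%:R ^+ 3 :> R by rewrite exprn_gt0 // ltr0n.
have tP : 0 < th * potential F by rewrite mulr_gt0.
have : #|av|%:R * (th / 8 * potential F) <= n%:R ^+ 3 * (th / 8 * potential F).
  by apply: ler_wpM2r => //; lra.
have : 0 < th * potential F * n%:R ^+ 3 by rewrite mulr_gt0.
lra.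
Qed.

Lemma potential_iter m : th <= 8 -> 6 * m%:R <= th * n%:R ->
  exists F, [/\ matching G F, (#|F| <= m)%N
    & potential F <= #|D|%:R * (1 - th / 8) ^+ m].
Proof.
move=> th8; elim: m => [|m IH] hm.
  exists set0; split; rewrite ?cards0 //.
    by split=> e; rewrite inE.
  rewrite expr0 mulr1 /potential -sum1_card natr_sum; apply: ler_sum => t _.
  by rewrite set0I cards0 expr0.
have [|F [mF Fm PF]] := IH.
  by apply: le_trans hm; rewrite -natr1; lra.
have [|F' [mF' Fm' PF']] := potential_step mF.
  by apply: le_trans hm; rewrite -[6]/(6%:R) -!natrM ler_nat; lia.
exists F'; split=> //; first exact: leq_trans Fm' _.
apply: le_trans PF' _; rewrite exprS mulrCA; apply: ler_wpM2l PF; lra.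
Qed.

(* Erdős–Selfridge derandomisation: a weight [2^-h] is given to a requirement
   [Q t] met [h] times, and edges are added so that the total weight decays. *)
Lemma exists_rich_matching j q :
  th <= 8 -> (1 - th / 8) ^+ j <= 4^-1 -> 6 * (j * q)%:R <= th * n%:R ->
  (#|D| < 2 ^ q)%N ->
  exists F, [/\ matching G F, (#|F| <= j * q)%N
    & forall t, t \in D -> (q < #|F :&: Q t|)%N].
Proof.
move=> th8 hj hjq Dq; have [F [mF Fm PF]] := potential_iter th8 hjq.
exists F; split=> // t tD; rewrite ltnNge; apply/negP => hq.
have h1 : 2^-1 ^+ #|F :&: Q t| <= potential F.
  rewrite /potential (bigD1 t) //= lerDl; apply: sumr_ge0 => s _.
  by apply: exprn_ge0; lra.
have h2 : 2^-1 ^+ q <= 2^-1 ^+ #|F :&: Q t| :> R.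
  by apply: ler_wiXn2l hq; lra.
(* Every [j] additions divide the bound by 4 and [#|D| < 2 ^ q], so the potential ends below
   [2^-1 ^+ q]. A requirement hit at most [q] times would alone weigh that much. *)
have h3 : #|D|%:R * (1 - th / 8) ^+ (j * q) <= #|D|%:R * 4^-1 ^+ q.
  rewrite exprM; apply: ler_wpM2l; first exact: ler0n.
  apply: lerXn2r => //; rewrite nnegrE; last by lra.
  by apply: exprn_ge0; lra.
have h4 : #|D|%:R < 2 ^+ q :> R by rewrite -natrX ltr_nat.
have h5 : 0 < 4^-1 ^+ q :> R by apply: exprn_gt0; lra.
have h6 : 2 ^+ q * 4^-1 ^+ q = 2^-1 ^+ q :> R.
  by rewrite -exprMn; congr (_ ^+ _); field.
have h7 : #|D|%:R * 4^-1 ^+ q < 2 ^+ q * 4^-1 ^+ q :> R by rewrite ltr_pM2r.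
lra.
Qed.
End Greedy.

(** * Counting absorbers and covering almost everything *)

Lemma notin_ex2 (T : finType) (X Y : {set T}) :
  (#|X| + #|Y| < #|T|)%N -> exists x, x \notin X /\ x \notin Y.
Proof.
move=> XY; have [x] := notin_ex (leq_ltn_trans (leq_card_setU X Y) XY).
by rewrite inE negb_or => /andP[xX xY]; exists x.
Qed.

Lemma card_setI_ge (R : realFieldType) (T : finType) (A B : {set T}) (x y : R) :
  x <= #|A|%:R -> #|~: B|%:R <= y -> x - y <= #|A :&: B|%:R.
Proof.
move=> xA yB; have : (#|A| <= #|A :&: B| + #|~: B|)%N.
  rewrite -(cardsID B A) leq_add2l; apply: subset_leq_card.
  by rewrite setDE subsetIr.
rewrite -(ler_nat R) natrD; lra.
Qed.

Lemma card_slices1 (R : realFieldType) (T1 T2 : finType) (S : {set T1 * T2})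
    (J : {set T1}) (x : R) :
  (forall j, j \in J -> x <= #|[set y | (j, y) \in S]|%:R) ->
  #|J|%:R * x <= #|S|%:R.
Proof.
move=> H; have -> : #|S| = (\sum_j #|[set y | (j, y) \in S]|)%N.
  under [RHS]eq_bigr do rewrite -sum1_card big_mkcond.
  rewrite pair_big /= -sum1_card big_mkcond.
  by apply: eq_bigr => -[j y] _ /=; rewrite inE.
rewrite natr_sum mulr_natl -sumr_const big_mkcond /=; apply: ler_sum => j _.
by case: ifP => // /H.
Qed.

Lemma card_slices2 (R : realFieldType) (T1 T2 : finType) (S : {set T1 * T2})
    (J : {set T2}) (x : R) :
  (forall j, j \in J -> x <= #|[set y | (y, j) \in S]|%:R) ->
  #|J|%:R * x <= #|S|%:R.
Proof.
move=> H; pose S' := [set p : T2 * T1 | (p.2, p.1) \in S].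
have -> : #|S| = #|S'|.
  have cK : cancel (fun p : T2 * T1 => (p.2, p.1)) (fun p => (p.2, p.1)) by case.
  rewrite -(card_imset S' (can_inj cK)); congr #|pred_of_set _|.
  apply/setP => -[a b]; apply/idP/imsetP => [abS|[[b' a']]].
    by exists (b, a); rewrite ?inE.
  by rewrite inE /= => ? [-> ->].
apply: card_slices1 => j /H; congr (_ <= _%:R); congr #|pred_of_set _|.
by apply/setP => y; rewrite !inE.
Qed.

Section Counting.
Variables (R : realFieldType) (V1 V2 C : finType) (n : nat).
Variables (G : C -> bigraph V1 V2) (mu d : R).
Hypotheses (n1 : #|V1| = n) (n2 : #|V2| = n) (n3 : #|C| = n).

Definition big1 (u : V1) (c : C) : bool :=
  (2^-1 - mu) * n%:R <= (deg1 (G c) u [set: V2])%:R.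
Definition big2 (v : V2) (c : C) : bool :=
  (2^-1 - mu) * n%:R <= (deg2 (G c) v [set: V1])%:R.

Hypothesis b1c : forall c, #|[set u | ~~ big1 u c]|%:R <= d * n%:R.
Hypothesis b2c : forall c, #|[set v | ~~ big2 v c]|%:R <= d * n%:R.
Hypothesis b1u : forall u, #|[set c | ~~ big1 u c]|%:R <= d * n%:R.
Hypothesis b2v : forall v, #|[set c | ~~ big2 v c]|%:R <= d * n%:R.

(** A one-sided form of niceness: the set [A] is fixed and only [B] varies. *)
Definition rich (kap th : R) (A : {set V1}) (c : C) : bool :=
  [forall B : {set V2}, ((2^-1 - kap) * n%:R <= #|B|%:R) ==>
    (th * n%:R ^+ 2 <= (edges_between (G c) A B)%:R)].

Definition richness (g kap th : R) : Prop :=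
  forall A : {set V1}, (2^-1 - kap) * n%:R <= #|A|%:R ->
    g * n%:R <= #|[set c | rich kap th A c]|%:R.

Definition nbr1 (c : C) (u : V1) := [set v | (u, v) \in G c].
Definition nbr2 (c : C) (v : V2) := [set u | (u, v) \in G c].

Lemma big1E u c : big1 u c = ((2^-1 - mu) * n%:R <= #|nbr1 c u|%:R).
Proof.
by rewrite /big1 /deg1; congr (_ <= #|pred_of_set _|%:R); apply/setP=> v; rewrite !inE.
Qed.

Lemma big2E v c : big2 v c = ((2^-1 - mu) * n%:R <= #|nbr2 c v|%:R).
Proof.
by rewrite /big2 /deg2; congr (_ <= #|pred_of_set _|%:R); apply/setP=> u; rewrite !inE.
Qed.

Definition edge_triples := [set e : V1 * V2 * C | e.1 \in G e.2].

(** Coordinates are chosen in turn: a colour [i] in which [v] has large degree (at least [99/100 n]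
    choices), a neighbour [a] of [v] of large degree in [i], and a neighbour [b] of [a] of large
    degree in [c] (at least [45/100 n] choices each). *)
Lemma card_exchangeable v c : mu <= 100^-1 -> 0 <= d <= 100^-1 ->
  (8^-1 : R) * n%:R ^+ 3 <= #|edge_triples :&: exchangeable G big2 v c|%:R.
Proof.
move=> mu1 /andP[d0 d1]; set S := _ :&: _.
have nn : 0 <= n%:R :> R by [].
pose J := [set i | big2 v i].
have JE : n%:R - d * n%:R <= #|J|%:R.
  rewrite -[J]setTI; apply: card_setI_ge; first by rewrite cardsT n3.
  by apply: le_trans (b2v v); rewrite ler_nat subset_leq_card //;
     apply/subsetP => i; rewrite !inE.
have slice i : i \in J -> (3 / 16 : R) * n%:R ^+ 2 <= #|[set p | (p, i) \in S]|%:R.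
  rewrite inE big2E => bi.
  pose K := nbr2 i v :&: [set a | big1 a i].
  have KE : (2^-1 - mu) * n%:R - d * n%:R <= #|K|%:R.
    apply: card_setI_ge => //; apply: le_trans (b1c i).
    by rewrite ler_nat subset_leq_card //; apply/subsetP => a; rewrite !inE.
  have slice2 a : a \in K -> (2^-1 - mu) * n%:R - d * n%:R <=
      #|[set b | (a, b) \in [set p | (p, i) \in S]]|%:R.
    rewrite !inE big1E => /andP[av ba].
    rewrite (_ : [set b | _] = nbr1 i a :&: [set b | big2 b c]); last first.
      by apply/setP => b; rewrite !inE /= av.
    apply: card_setI_ge => //; apply: le_trans (b2c c).
    by rewrite ler_nat subset_leq_card //; apply/subsetP => b; rewrite !inE.
  apply: le_trans (card_slices1 slice2).
  have h : (45 / 100 : R) * n%:R <= (2^-1 - mu) * n%:R - d * n%:R by nra.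
  have : ((45 / 100 : R) * n%:R) * (45 / 100 * n%:R) <=
      #|K|%:R * ((2^-1 - mu) * n%:R - d * n%:R).
    apply: ler_pM.
    - lra.
    - lra.
    - lra.
    - exact: h.
  by have := sqr_ge0 (n%:R : R); rewrite expr2; lra.
apply: le_trans (card_slices2 slice).
have h : (99 / 100 : R) * n%:R <= #|J|%:R by have := ler_wpM2r nn d1; lra.
have : ((99 / 100 : R) * n%:R) * (3 / 16 * n%:R ^+ 2) <= #|J|%:R * (3 / 16 * n%:R ^+ 2).
  by apply: ler_wpM2r => //; apply: mulr_ge0; [lra|exact: sqr_ge0].
have : 0 <= n%:R ^+ 3 :> R by apply: exprn_ge0.
rewrite exprS; lra.
Qed.

(** The neighbourhood [A] of [b] in colour [c] is about half of [V1]. At least [(g - d) n] colours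
    [i] are rich for [A] and give [u] large degree; each edge of [G i] between [A] and the
    neighbourhood of [u] in [i] is then an absorber. *)
Lemma card_absorbing g kap th u b c :
  richness g kap th -> mu <= kap -> 0 <= th -> big2 b c ->
  (g - d) * th * n%:R ^+ 3 <= #|edge_triples :&: absorbing G u b c|%:R.
Proof.
move=> rG mk th0 bc; set S := _ :&: _.
have nn : 0 <= n%:R :> R by [].
have wk (x : R) : (2^-1 - mu) * n%:R <= x -> (2^-1 - kap) * n%:R <= x.
  by apply: le_trans; apply: ler_wpM2r => //; lra.
pose A := nbr2 c b.
pose J := [set i | rich kap th A i] :&: [set i | big1 u i].
have JE : g * n%:R - d * n%:R <= #|J|%:R.
  apply: card_setI_ge; first by apply: rG; apply: wk; rewrite -big2E.
  by apply: le_trans (b1u u); rewrite ler_nat subset_leq_card //;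
     apply/subsetP => i; rewrite !inE.
have slice i : i \in J -> th * n%:R ^+ 2 <= #|[set p | (p, i) \in S]|%:R.
  rewrite !inE => /andP[/forallP/(_ (nbr1 i u))/implyP H bi].
  have := H (wk _ _); rewrite -big1E => /(_ bi) /le_trans; apply.
  rewrite ler_nat subset_leq_card //; apply/subsetP => p.
  by rewrite /A !inE /= => /and3P[-> -> ->].
apply: le_trans (card_slices2 slice).
rewrite exprS.
have := ler_wpM2r (mulr_ge0 th0 (sqr_ge0 n%:R)) JE; lra.
Qed.

(** * Maximum matchings are nearly perfect *)

Lemma max_matching_cov2 F M u b c :
  max_matching G F M -> u \notin cov1 M -> c \notin cov3 M ->
  (u, b) \in G c -> b \in cov2 M.
Proof.
move=> [mM FM maxM] uM cM ub; apply/negPn/negP => bM.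
have f : fits M (u, b, c) by rewrite /fits /= uM bM cM.
have := maxM ((u, b, c) |: M) (@matchingU1 _ _ _ _ _ (u, b, c) mM ub f) (subset_trans FM (subsetUr _ _)).
by rewrite cardsU1 fits_notin // add1n ltnn.
Qed.

Lemma max_matching_cov1 F M a v c :
  max_matching G F M -> v \notin cov2 M -> c \notin cov3 M ->
  (a, v) \in G c -> a \in cov1 M.
Proof.
move=> [mM FM maxM] vM cM av; apply/negPn/negP => aM.
have f : fits M (a, v, c) by rewrite /fits /= vM aM cM.
have := maxM ((a, v, c) |: M) (@matchingU1 _ _ _ _ _ (a, v, c) mM av f) (subset_trans FM (subsetUr _ _)).
by rewrite cardsU1 fits_notin // add1n ltnn.
Qed.

(** The edges through which [u] can enter the matching in colour [c]: it takes over the second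
    vertex and releases the first. In [in_edges] the sides are exchanged. *)
Definition out_edges F M c u :=
  [set e in M :\: F | (u, e.1.2) \in G c] : {set V1 * V2 * C}.
Definition in_edges F M c v :=
  [set e in M :\: F | (e.1.1, v) \in G c] : {set V1 * V2 * C}.

(** By maximality every neighbour of [u] in colour [c] is covered, and at most [#|F|] of them are
    covered by [F]. *)
Lemma card_out_edges be F M u c :
  max_matching G F M -> #|F|%:R <= be * n%:R ->
  u \notin cov1 M -> c \notin cov3 M -> big1 u c ->
  (2^-1 - (mu + be)) * n%:R <= #|out_edges F M c u|%:R.
Proof.
move=> maxM Fbe uM cM; rewrite big1E => bu.
have : (#|nbr1 c u| <= #|out_edges F M c u| + #|F|)%N.
  apply: leq_trans (leq_add (leq_imset_card (fun e => e.1.2) _)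
                            (leq_imset_card (fun e => e.1.2) _)).
  apply: leq_trans (leq_card_setU _ _); apply: subset_leq_card.
  apply/subsetP => b; rewrite !inE => ub.
  have /imsetP[e eM be'] := max_matching_cov2 maxM uM cM ub.
  apply/orP; have [eF|eF] := boolP (e \in F).
    by right; apply/imsetP; exists e.
  by left; apply/imsetP; exists e; rewrite // !inE eF eM -be'.
rewrite -(ler_nat R) natrD; lra.
Qed.

Lemma card_in_edges be F M v c :
  max_matching G F M -> #|F|%:R <= be * n%:R ->
  v \notin cov2 M -> c \notin cov3 M -> big2 v c ->
  (2^-1 - (mu + be)) * n%:R <= #|in_edges F M c v|%:R.
Proof.
move=> maxM Fbe vM cM; rewrite big2E => bv.
have : (#|nbr2 c v| <= #|in_edges F M c v| + #|F|)%N.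
  apply: leq_trans (leq_add (leq_imset_card (fun e => e.1.1) _)
                            (leq_imset_card (fun e => e.1.1) _)).
  apply: leq_trans (leq_card_setU _ _); apply: subset_leq_card.
  apply/subsetP => a; rewrite !inE => av.
  have /imsetP[e eM ae] := max_matching_cov1 maxM vM cM av.
  apply/orP; have [eF|eF] := boolP (e \in F).
    by right; apply/imsetP; exists e.
  by left; apply/imsetP; exists e; rewrite // !inE eF eM -ae.
rewrite -(ler_nat R) natrD; lra.
Qed.

(** The edges lie in two stars, centred at [a] and [b], with at most [n] edges each. *)
Lemma card_edges_star_le (H : bigraph V1 V2) (A : {set V1}) (B : {set V2}) a b :
  (forall x y, (x, y) \in H -> x \in A -> y \in B -> x = a \/ y = b) ->
  (edges_between H A B <= 2 * n)%N.
Proof.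
move=> E; have sub : [set e in H | (e.1 \in A) && (e.2 \in B)] \subset
    setX [set a] [set: V2] :|: setX [set: V1] [set b].
  apply/subsetP => -[x y]; rewrite !inE /= => /and3P[xyH xA yB].
  by have [->|->] := E x y xyH xA yB; rewrite eqxx ?orbT.
apply: leq_trans (subset_leq_card sub) _.
apply: leq_trans (leq_card_setU _ _) _.
by rewrite !cardsX !cardsT !cards1 n1 n2 mul1n muln1 addnn mul2n.
Qed.

Lemma max_matching_card g kap th be F M :
  0 <= d -> richness g kap th -> mu + be <= kap ->
  2 * (mu + be) * n%:R < g * n%:R -> 2 * n%:R < th * n%:R ^+ 2 ->
  max_matching G F M -> #|F|%:R <= be * n%:R ->
  n%:R < #|M|%:R + d * n%:R + 4.
Proof.
move=> d0 rG kapP gP thP maxM Fbe; rewrite ltNge; apply/negP => Mn.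
have [mM FM _] := maxM.
have dn0 : 0 <= d * n%:R by apply: mulr_ge0.
have M4 : (#|M| + 4 <= n)%N by rewrite -(ler_nat R) natrD; lra.
(* The additive 4 pays for four distinct free colours. On each side, two uncovered vertices are
   chosen with large degree in a prescribed colour, at a cost of [d * n] exceptions and one earlier
   choice. *)
have fresh3 (s : seq C) : (size s < 4)%N ->
    exists c, c \notin cov3 M /\ c \notin [set x in s].
  move=> s4; apply: notin_ex2; rewrite (card_cov3 mM) n3.
  apply: leq_trans M4; rewrite -addnS leq_add2l ltnS cardsE.
  exact: leq_trans (card_size s) _.
have fresh1 (c : C) (s : seq V1) : (size s < 2)%N ->
    exists u, [/\ u \notin cov1 M, u \notin s & big1 u c].
  move=> s4.
  have [|u []] := @notin_ex2 _ (cov1 M) ([set x in s] :|: [set u | ~~ big1 u c]).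
    rewrite (card_cov1 mM) n1 -(ltr_nat R) natrD.
    have : (#|[set x in s] :|: [set u | ~~ big1 u c]|)%:R <=
        1 + #|[set u | ~~ big1 u c]|%:R :> R.
      rewrite -[1]/(1%:R) -natrD ler_nat; apply: leq_trans (leq_card_setU _ _) _.
      rewrite leq_add2r cardsE; exact: leq_trans (card_size s) _.
    have := b1c c; lra.
  by rewrite !inE negb_or negbK => uM /andP[us bu]; exists u.
have fresh2 (c : C) (s : seq V2) : (size s < 2)%N ->
    exists v, [/\ v \notin cov2 M, v \notin s & big2 v c].
  move=> s4.
  have [|v []] := @notin_ex2 _ (cov2 M) ([set x in s] :|: [set v | ~~ big2 v c]).
    rewrite (card_cov2 mM) n2 -(ltr_nat R) natrD.
    have : (#|[set x in s] :|: [set v | ~~ big2 v c]|)%:R <=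
        1 + #|[set v | ~~ big2 v c]|%:R :> R.
      rewrite -[1]/(1%:R) -natrD ler_nat; apply: leq_trans (leq_card_setU _ _) _.
      rewrite leq_add2r cardsE; exact: leq_trans (card_size s) _.
    have := b2c c; lra.
  by rewrite !inE negb_or negbK => vM /andP[vs bv]; exists v.
have [c1 [c1M _]] := fresh3 [::] isT.
have [c2 [c2M]] := fresh3 [:: c1] isT; rewrite !inE => c21.
have [c3 [c3M]] := fresh3 [:: c1; c2] isT; rewrite !inE negb_or => /andP[c31 c32].
have [c4 [c4M]] := fresh3 [:: c1; c2; c3] isT.
rewrite !inE !negb_or => /and3P[c41 c42 c43].
have [u1 [u1M _ bu1]] := fresh1 c1 [::] isT.
have [u3 [u3M u31 bu3]] := fresh1 c3 [:: u1] isT; rewrite inE in u31.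
have [v2 [v2M _ bv2]] := fresh2 c2 [::] isT.
have [v4 [v4M v42 bv4]] := fresh2 c4 [:: v2] isT; rewrite inE in v42.
have X1 := card_out_edges maxM Fbe u1M c1M bu1.
have Y2 := card_in_edges maxM Fbe v2M c2M bv2.
have X3 := card_out_edges maxM Fbe u3M c3M bu3.
have Y4 := card_in_edges maxM Fbe v4M c4M bv4.
have [_ I1 I2 I3] := mM.
have outM c u : out_edges F M c u \subset M.
  by apply/subsetP => e; rewrite !inE => /andP[/andP[]].
have inM c v : in_edges F M c v \subset M.
  by apply/subsetP => e; rewrite !inE => /andP[/andP[]].
(* The vertices released when [u1] enters in colour [c1], and below those released when [v2] enters
   in colour [c2]. An edge from [A] to [B] in a further free colour would allow an augmentation. *)
pose A := cov1 (out_edges F M c1 u1).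
pose B := cov2 (in_edges F M c2 v2).
have cA : #|A| = #|out_edges F M c1 u1| := card_cov1 (matchingS (outM _ _) mM).
have cB : #|B| = #|in_edges F M c2 v2| := card_cov2 (matchingS (inM _ _) mM).
have wk (x : R) : (2^-1 - (mu + be)) * n%:R <= x -> (2^-1 - kap) * n%:R <= x.
  by apply: le_trans; apply: ler_wpM2r => //; lra.
have richA := rG A; rewrite cA in richA; have {}richA := richA (wk _ X1).
pose E34 := out_edges F M c3 u3 :|: in_edges F M c4 v4.
have E34M : E34 \subset M by rewrite subUset outM inM.
(* A common edge could be rotated. Hence [E34] has at least [(1 - 2 (mu + be)) n] edges, and since
   [2 (mu + be) < g] one of their colours is rich for [A]. *)
have cE : #|E34| = (#|out_edges F M c3 u3| + #|in_edges F M c4 v4|)%N.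
  rewrite cardsU (_ : _ :&: _ = set0) ?cards0 ?subn0 //; apply/setP => e.
  rewrite [RHS]inE; apply/negP; rewrite in_setI [_ \in out_edges _ _ _ _]inE.
  rewrite [_ \in in_edges _ _ _ _]inE => /andP[/andP[eM ub] /andP[_ av]].
  by apply: (max_matching_rotate maxM eM u3M v4M c3M c4M) => //; rewrite eq_sym.
have [e0 e0E e0r] : exists2 e0, e0 \in E34 & rich kap th A e0.2.
  have : (0 < #|[set c | rich kap th A c] :&: cov3 E34|)%N.
    rewrite lt0n; apply/eqP => I0.
    have := max_card (mem ([set c | rich kap th A c] :|: cov3 E34)).
    rewrite cardsU I0 subn0 n3 (card_cov3 (matchingS E34M mM)) cE.
    by rewrite -(ler_nat R) !natrD; lra.
  by case/card_gt0P => c; rewrite !inE => /andP[cr /imsetP[e eE ec]];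
    exists e; rewrite // -ec.
have e0MF : e0 \in M :\: F.
  by move: e0E; rewrite inE => /orP[]; rewrite inE => /andP[].
have e0M : e0 \in M by have /setDP[] := e0MF.
have e03 : e0.2 \in cov3 M by apply/imsetP; exists e0.
have e02 : e0.1.2 \in cov2 M by apply/imsetP; exists e0.
have e01 : e0.1.1 \in cov1 M by apply/imsetP; exists e0.
(* Once [f] replaces [e0], the rich colour [e0.2] is free, so its edges between [A] and [B] all meet
   [e0]. There are at most [2 n] of them, fewer than richness demands. *)
have main f : f.1 \in G f.2 -> fits (M :\ e0) f -> f.1.1 != u1 -> f.1.2 != v2 ->
    f.2 != c1 -> f.2 != c2 -> f.2 != e0.2 -> False.
  move=> fG ff fu fv fc1 fc2 fe0.
  have : (edges_between (G e0.2) A B <= 2 * n)%N.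
    apply: (@card_edges_star_le _ _ _ e0.1.1 e0.1.2) => x y xy /imsetP[e eX xe] /imsetP[e' eY ye'].
    have [ee0|ee0] := eqVneq e e0; first by left; rewrite xe ee0.
    have [e'e0|e'e0] := eqVneq e' e0; first by right; rewrite ye' e'e0.
    move: eX eY; rewrite inE => /andP[eM ub]; rewrite inE => /andP[e'M av].
    have c12 : c1 != c2 by rewrite eq_sym.
    have := max_matching_no_edge_swap maxM e0MF fG ff fu fv fc1 fc2 fe0 u1M v2M
      c1M c2M c12 eM e'M ee0 e'e0 ub av.
    by rewrite -xe -ye' xy.
  rewrite -(ler_nat R) natrM => h.
  have := forallP e0r B; rewrite cB (wk _ Y2) /=; lra.
(* The replacement of [e0] lets in [u3] with colour [c3], or [v4] with colour [c4], according to the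
   family containing [e0]. *)
move: e0E; rewrite inE => /orP[]; rewrite inE => /andP[_ h].
- apply: (main (u3, e0.1.2, c3)) => //=.
  + rewrite /fits (cov1D mM e0M) (cov2D mM e0M) (cov3D mM e0M) !inE /= eqxx /=.
    by rewrite (negbTE u3M) (negbTE c3M) !andbF.
  + by apply: contraNneq v2M => <-.
  + by apply: contraNneq c3M => ->.
- apply: (main (e0.1.1, v4, c4)) => //=.
  + rewrite /fits (cov1D mM e0M) (cov2D mM e0M) (cov3D mM e0M) !inE /= eqxx /=.
    by rewrite (negbTE v4M) (negbTE c4M) !andbF.
  + by apply: contraNneq u1M => <-.
  + by apply: contraNneq c4M => ->.
Qed.
End Counting.

(** * Stability implies richness *)

Lemma symdiff_triangle (T : finType) (Z A B : {set T}) :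
  (#|symdiff A B| <= #|symdiff Z A| + #|symdiff Z B|)%N.
Proof.
apply: leq_trans (leq_card_setU _ _); apply: subset_leq_card.
by apply/subsetP => x; rewrite !inE; case: (x \in A); case: (x \in B); case: (x \in Z).
Qed.

Lemma card_symdiff (T : finType) (A B : {set T}) :
  (#|symdiff A B| + 2 * #|A :&: B| = #|A| + #|B|)%N.
Proof.
have -> : #|symdiff A B| = (#|A :\: B| + #|B :\: A|)%N.
  rewrite /symdiff cardsU (_ : _ :&: _ = set0) ?cards0 ?subn0 //.
  by apply/setP => x; rewrite !inE; case: (x \in A); case: (x \in B).
rewrite -(cardsID B A) -(cardsID A B) [B :&: A]setIC; lia.
Qed.

Lemma card_tripartition (T : finType) (A X Y Z : {set T}) :
  tripartition X Y Z -> (#|A| = #|A :&: X| + #|A :&: Y| + #|A :&: Z|)%N.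
Proof.
move=> [U XY XZ YZ]; rewrite -[A in LHS]setIT -U !setIUr.
have D (P Q : {set T}) : [disjoint P & Q] -> A :&: P :&: (A :&: Q) = set0.
  by move=> PQ; rewrite setIACA setIid (disjoint_setI0 PQ) setI0.
rewrite cardsU cardsU D // cards0 subn0 setIUl !D // setU0 cards0 subn0 //.
Qed.

Section Richness.
Variables (R : realType) (n : nat) (V1 V2 : finType).
Variables (G : 'I_n -> bigraph V1 V2) (P : 'I_n -> sextuple V1 V2).
Hypotheses (n1 : #|V1| = n) (n2 : #|V2| = n).

(** A nice colour is rich for every admissible [A] at once. *)
Lemma richness_strongly_stable (gamma alpha : R) :
  strongly_stable gamma alpha G -> richness n G gamma alpha alpha.
Proof.
rewrite /strongly_stable => st A hA; apply: le_trans st _.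
rewrite ler_nat; apply: subset_leq_card; apply/subsetP => i.
rewrite !inE => /forallP/(_ A)/forallP ni; apply/forallP => B; apply/implyP => hB.
by have := ni B; rewrite n1 hA hB.
Qed.

Variables (eps delta : R).
Hypotheses (eps_gt0 : 0 < eps) (delta1 : delta <= 1) (eps60 : 60 * eps <= delta).
Hypothesis (n_big : 1 <= eps * n%:R).

(** Rounding moves the part sizes by less than 1, which is at most [eps * n]; this turns [eps] into
    [2 * eps] and [2 * eps] into [4 * eps]. *)
Lemma char_partition_card1 i : char_partition eps (G i) (P i) ->
  [/\ tripartition (A1 (P i)) (B1 (P i)) (C1 (P i)),
      (2^-1 - 2 * eps) * n%:R <= #|A1 (P i)|%:R <= (2^-1 : R) * n%:R,
      (2^-1 - 2 * eps) * n%:R <= #|B1 (P i)|%:R <= (2^-1 : R) * n%:R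
    & #|C1 (P i)|%:R <= 4 * eps * n%:R].
Proof.
move=> [t1 _ [m + [a1 b1 _ _]] _ _]; have nb := n_big; rewrite ltr_norml n1 => /andP[m1 m2].
have := card_tripartition [set: V1] t1.
rewrite !setTI cardsT n1 a1 b1 => E.
have : n%:R = m%:R + m%:R + #|C1 (P i)|%:R :> R by rewrite -!natrD -E.
by move=> E'; split; rewrite ?a1 ?b1 //; [apply/andP; split|apply/andP; split|]; lra.
Qed.

Lemma char_partition_card2 i : char_partition eps (G i) (P i) ->
  tripartition (A2 (P i)) (B2 (P i)) (C2 (P i)) /\
  #|C2 (P i)|%:R <= 4 * eps * n%:R :> R.
Proof.
move=> [_ t2 [m + [_ _ a2 b2]] _ _]; have nb := n_big; rewrite ltr_norml n1 => /andP[m1 m2].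
have := card_tripartition [set: V2] t2.
rewrite !setTI cardsT n2 a2 b2 => E; split=> //.
have : n%:R = m%:R + m%:R + #|C2 (P i)|%:R :> R by rewrite -!natrD -E.
by lra.
Qed.

(** All but [14 eps n] elements of [A] lie in [Y], and [#|Y|] exceeds [#|A|] by at most [eps n];
    hence the constant [29 = 2 * 14 + 1]. *)
Lemma symdiff_of_small_inter (A X Y Z : {set V1}) :
  tripartition X Y Z ->
  (2^-1 - 2 * eps) * n%:R <= #|X|%:R <= (2^-1 : R) * n%:R ->
  (2^-1 - 2 * eps) * n%:R <= #|Y|%:R <= (2^-1 : R) * n%:R ->
  #|Z|%:R <= 4 * eps * n%:R -> (2^-1 - eps) * n%:R <= #|A|%:R ->
  #|A :&: X|%:R < 10 * eps * n%:R ->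
  #|symdiff A Y|%:R <= 29 * eps * n%:R /\
  #|symdiff (~: A) X|%:R <= 29 * eps * n%:R.
Proof.
move=> t /andP[X1 X2] /andP[Y1 Y2] Zle Age AX.
have c1 := card_tripartition A t.
have AZ : (#|A :&: Z| <= #|Z|)%N by rewrite subset_leq_card // subsetIr.
have c3 := card_symdiff A Y.
have c4 := card_symdiff (~: A) X.
have c5 := cardsC A; rewrite n1 in c5.
have c6 : (#|~: A :&: X| + #|A :&: X| = #|X|)%N.
  by rewrite addnC -(cardsID A X) setIC setDE [X :&: ~: A]setIC.
have toR (k l : nat) : k = l -> k%:R = l%:R :> R by move=> ->.
move: (toR _ _ c1) (toR _ _ c3) (toR _ _ c4) (toR _ _ c5) (toR _ _ c6).
rewrite !natrD; move: AZ; rewrite -(ler_nat R).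
by move=> *; split; lra.
Qed.

(** A vertex of [X2] misses at most [2 eps n] vertices of [X1], so it has at least [8 eps n]
    neighbours in [A]; there are at least [n / 5] such vertices in [B]. *)
Lemma rich_half i (A : {set V1}) (B X2 : {set V2}) (X1 : {set V1}) :
  #|X1|%:R <= (2^-1 : R) * n%:R -> 10 * eps * n%:R <= #|A :&: X1|%:R ->
  (n%:R : R) / 5 <= #|B :&: X2|%:R ->
  (forall v, v \in X2 -> (2^-1 - 2 * eps) * n%:R <= (deg2 (G i) v X1)%:R) ->
  eps * n%:R ^+ 2 <= (edges_between (G i) A B)%:R.
Proof.
move=> X1le AX1 BX2 dX.
have slice v : v \in B :&: X2 -> 8 * eps * n%:R <=
    #|[set u | (u, v) \in [set e in G i | (e.1 \in A) && (e.2 \in B)]]|%:R.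
  rewrite inE => /andP[vB vX]; have := dX v vX.
  set N := [set u in X1 | (u, v) \in G i]; rewrite -[deg2 _ _ _]/(#|N|) => dN.
  have : (#|A :&: X1| + #|N| <=
      #|[set u | (u, v) \in [set e in G i | (e.1 \in A) && (e.2 \in B)]]| + #|X1|)%N.
    rewrite -cardsUI addnC; apply: leq_add; apply: subset_leq_card.
      by apply/subsetP => u; rewrite !inE /= vB => /and3P[/andP[-> _] _ ->].
    by apply/subsetP => u; rewrite !inE => /orP[] /andP[].
  rewrite -(ler_nat R) !natrD; lra.
apply: le_trans (card_slices2 slice).
have ep := eps_gt0.
have e0 : 0 <= 8 * eps * n%:R by apply: mulr_ge0 => //; lra.
have := ler_wpM2r e0 BX2.
have : 0 <= eps * n%:R ^+ 2 by apply: mulr_ge0; [lra|exact: sqr_ge0].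
rewrite expr2; lra.
Qed.

(** As the part [C2] is small, [B] meets the part [A2] or the part [B2] in at least [n / 5]
    vertices. *)
Lemma rich_of_inter i (A : {set V1}) :
  char_partition eps (G i) (P i) ->
  10 * eps * n%:R <= #|A :&: A1 (P i)|%:R ->
  10 * eps * n%:R <= #|A :&: B1 (P i)|%:R ->
  rich n G eps eps A i.
Proof.
move=> cp iA iB; have [d1 e60] := (delta1, eps60).
apply/forallP => B; apply/implyP => hB.
have [_ /andP[_ a1] /andP[_ b1] _] := char_partition_card1 cp.
have [t2 c2] := char_partition_card2 cp.
have [_ _ _ [dA _ dB _] _] := cp; rewrite n1 in dA dB.
have cB := card_tripartition B t2.
have cC : (#|B :&: C2 (P i)| <= #|C2 (P i)|)%N.
  by rewrite subset_leq_card // subsetIr.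
have [h|h] := leP (n%:R / 5) (#|B :&: A2 (P i)|%:R : R).
  exact: (rich_half a1 iA h dA).
apply: (rich_half b1 iB _ dB).
have := congr1 (fun k => k%:R : R) cB; rewrite !natrD.
move: cC; rewrite -(ler_nat R) => cC E.
have : eps * n%:R <= 60^-1 * n%:R by apply: ler_wpM2r => //; lra.
by have := ler0n R n; lra.
Qed.

Lemma close_of_not_rich i (A : {set V1}) :
  char_partition eps (G i) (P i) -> (2^-1 - eps) * n%:R <= #|A|%:R ->
  ~~ rich n G eps eps A i ->
  (#|symdiff A (B1 (P i))|%:R <= 29 * eps * n%:R /\
   #|symdiff (~: A) (A1 (P i))|%:R <= 29 * eps * n%:R) \/
  (#|symdiff A (A1 (P i))|%:R <= 29 * eps * n%:R /\
   #|symdiff (~: A) (B1 (P i))|%:R <= 29 * eps * n%:R).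
Proof.
move=> cp hA nr; have [t1 a1 b1 c1] := char_partition_card1 cp.
have [iA|iA] := leP (10 * eps * n%:R) (#|A :&: A1 (P i)|%:R : R); last first.
  by left; apply: symdiff_of_small_inter t1 a1 b1 c1 hA iA.
have [iB|iB] := leP (10 * eps * n%:R) (#|A :&: B1 (P i)|%:R : R).
  by rewrite rich_of_inter in nr.
right; apply: symdiff_of_small_inter _ b1 a1 c1 hA iB.
by case: t1 => U D1 D2 D3; split; rewrite // 1?[B1 _ :|: _]setUC // disjoint_sym.
Qed.

(** If both colours fail, [A1 (P i)] is close to [A] or to its complement, and so is one of
    [A1 (P j)] and [B1 (P j)], to the same set. The distance is at most [58 eps n], below
    [delta n]. *)
Lemma crossing_rich i j (A : {set V1}) :
  char_partition eps (G i) (P i) -> char_partition eps (G j) (P j) ->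
  (2^-1 - eps) * n%:R <= #|A|%:R -> crossing delta (P i) (P j) ->
  rich n G eps eps A i || rich n G eps eps A j.
Proof.
move=> ci cj hA; rewrite /crossing n1 => /andP[x1 x2].
apply/norP => -[/(close_of_not_rich ci hA) ni /(close_of_not_rich cj hA) nj].
have K (S : {set V1}) Z : delta * n%:R <= #|symdiff (A1 (P i)) S|%:R ->
    #|symdiff Z (A1 (P i))|%:R <= 29 * eps * n%:R ->
    #|symdiff Z S|%:R <= 29 * eps * n%:R -> False.
  move=> h1 h2 h3; have := symdiff_triangle Z (A1 (P i)) S.
  rewrite -(ler_nat R) natrD => h4.
  have : 60 * eps * n%:R <= delta * n%:R by apply: ler_wpM2r.
  by have := n_big; lra.
by case: ni => -[i1 i2]; case: nj => -[j1 j2];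
  [apply: (K _ (~: A) x1)|apply: (K _ (~: A) x2)|apply: (K _ A x2)|apply: (K _ A x1)].
Qed.

(** The colours rich for [A] form a vertex cover of the cross graph, so it has at most [2 n] times
    as many edges as there are rich colours. *)
Lemma richness_weakly_stable :
  (forall i, extremal eps (G i) -> char_partition eps (G i) (P i)) ->
  weakly_stable eps delta G P -> richness n G (delta / 2) eps eps.
Proof.
move=> cp; rewrite /weakly_stable => ws A hA.
set I := [set c | rich n G eps eps A c].
have sub : [set p : 'I_n * 'I_n | (p.1 < p.2)%N && cross_graph eps delta G P p.1 p.2]
    \subset setX I [set: 'I_n] :|: setX [set: 'I_n] I.
  apply/subsetP => -[i j]; rewrite !inE /= andbT.
  case/andP=> _ /and4P[_ /cp ci /cp cj /orP[x|x]].
    exact: crossing_rich x.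
  by rewrite orbC; apply: crossing_rich x.
have := leq_trans (subset_leq_card sub) (leq_card_setU _ _).
rewrite !cardsX cardsT card_ord -/(num_edges _) mulnC addnn -mul2n => h.
have n0 : 0 < n%:R :> R.
  by rewrite lt0r ler0n andbT; apply/eqP => n0; move: n_big; rewrite n0 mulr0 ler10.
rewrite -(ler_pM2r n0); move: ws; rewrite expr2.
move: h; rewrite -(ler_nat R) !natrM; lra.
Qed.
End Richness.

(** * Conclusion *)

(** By Bernoulli, [(1 + x) ^+ j] is at least 4 once [j >= 3 / x], while its product with
    [(1 - x) ^+ j] is at most 1. *)
Lemma expr_decay (R : realType) (x : R) : 0 < x <= 1 ->
  exists j, (1 - x) ^+ j <= 4^-1.
Proof.
move=> /andP[x0 x1].
have bern k : 1 + k%:R * x <= (1 + x) ^+ k.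
  elim: k => [|k IH]; first by rewrite expr0 mul0r addr0.
  rewrite exprS; apply: le_trans (ler_wpM2l _ IH); last by lra.
  have : 0 <= k%:R * x * x by rewrite !mulr_ge0 // ltW.
  rewrite -natr1; lra.
have [j jx] : exists j : nat, 3 / x <= j%:R.
  by exists (Num.truncn (3 / x)).+1; apply: ltW; apply: truncnS_gt.
exists j; have h1 := bern j.
have h2 : 3 <= j%:R * x by rewrite -ler_pdivrMr.
have h3 : (1 - x) ^+ j * (1 + x) ^+ j <= 1.
  rewrite -exprMn; apply: exprn_ile1; first by apply: mulr_ge0; lra.
  by have := mulr_ge0 (ltW x0) (ltW x0); lra.
have h4 : 0 <= (1 - x) ^+ j by apply: exprn_ge0; lra.
have h5 : (1 - x) ^+ j * 4 <= (1 - x) ^+ j * (1 + x) ^+ j.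
  by apply: ler_wpM2l => //; lra.
lra.
Qed.

(** Bounds the number of absorption requirements, at most [2 n ^ 3], by [2 ^ q] with [q = n %/ L].
    With [p = q %/ 4], the left side is at most [128 L ^ 3 (p + 1) ^ 3] and the right side at least
    [(p + 1) ^ 4]. *)
Lemma cube_lt_exp2 L : (0 < L)%N ->
  exists N, forall n, (N <= n)%N -> (2 * n ^ 3 < 2 ^ (n %/ L))%N.
Proof.
move=> L0; exists (L * (4 * (128 * L ^ 3)))%N => n hn.
set q := (n %/ L)%N; set p := (q %/ 4)%N.
have hq : (4 * (128 * L ^ 3) <= q)%N by rewrite leq_divRL // mulnC.
have hp : (128 * L ^ 3 <= p)%N by rewrite leq_divRL // mulnC.
have hn1 : (n <= L * (4 * p.+1))%N.
  apply: ltnW; apply: leq_trans (ltn_ceil n L0) _.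
  by rewrite mulnC leq_pmul2l // [(4 * _)%N]mulnC ltn_ceil.
have h1 : (2 * n ^ 3 <= 128 * L ^ 3 * p.+1 ^ 3)%N.
  apply: (@leq_trans (2 * (L * (4 * p.+1)) ^ 3)).
    by rewrite leq_pmul2l // leq_exp2r.
  by rewrite !expnMn; apply: eq_leq; ring.
have h2 : (p.+1 ^ 4 <= 2 ^ q)%N.
  apply: (@leq_trans ((2 ^ p) ^ 4)); first by rewrite leq_exp2r // ltn_expl.
  by rewrite -expnM leq_exp2l // leq_divM.
apply: leq_ltn_trans h1 _; apply: leq_trans h2.
by rewrite [(_ ^ 4)%N]expnS ltn_pmul2r ?expn_gt0.
Qed.

Lemma transversal_of_richness (R : realType) (g al : R) :
  0 < g <= 1 -> 0 < al <= 100^-1 ->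
  exists2 be : R, 0 < be & exists2 d0 : R, 0 < d0 & exists N : nat,
  forall (mu d : R) (n : nat), mu <= be -> 0 <= d <= d0 -> (N <= n)%N ->
  forall (V1 V2 : finType) (G : 'I_n -> bigraph V1 V2),
  #|V1| = n -> #|V2| = n -> (0 < n)%N ->
  richness n G g al al ->
  (forall c, #|[set u | ~~ big1 n G mu u c]|%:R <= d * n%:R) ->
  (forall c, #|[set v | ~~ big2 n G mu v c]|%:R <= d * n%:R) ->
  (forall u, #|[set c | ~~ big1 n G mu u c]|%:R <= d * n%:R) ->
  (forall v, #|[set c | ~~ big2 n G mu v c]|%:R <= d * n%:R) ->
  has_transversal_perfect_matching G.
Proof.
move=> /andP[g0 g1] /andP[al0 al1].
have gal0 : 0 < g * al by apply: mulr_gt0.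
have gal1 : g * al <= al by rewrite -[leRHS]mul1r; apply: ler_wpM2r g1; apply: ltW.
have gal2 : g * al <= 100^-1 * g by rewrite mulrC; apply: ler_wpM2r al1; apply: ltW.
(* The density [th] of absorbers comes from [(g - d) * al] with [d <= g / 2]; [be] bounds both [mu]
   and [#|F| / n]. *)
pose th := g * al / 2; pose be := g * al / 100.
have th0 : 0 < th by rewrite /th; lra.
have be0 : 0 < be by rewrite /be; lra.
have [|j hj] := @expr_decay R (th / 8); first by rewrite /th; lra.
(* With [q = n %/ L], the [j * q] edges of [F] number at most [be * n]. *)
pose L := (Num.truncn (j%:R / be)).+1.
have jL : j%:R <= be * L%:R.
  by rewrite mulrC -ler_pdivrMr // ltW // truncnS_gt.
have L0 : 0 < L%:R :> R by rewrite ltr0n.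
have [N0 hN0] := @cube_lt_exp2 L isT.
exists be => //.
(* The bounds serve, in order, the count of exchangeable edges, the count of absorbers, and the
   comparison of [d * n] with the hits provided by [F]. *)
exists (Num.min 100^-1 (Num.min (g / 2) (8 * L%:R)^-1)).
  rewrite !lt_min; apply/and3P; split; rewrite ?invr_gt0 //; first by lra.
  exact: mulr_gt0.
exists (maxn N0 (maxn (16 * L) (Num.truncn (2 / al)).+1)) => mu d n mube /andP[d0].
rewrite !le_min => /and3P[d1 dg dL]; rewrite !geq_max => /and3P[nN0 nL nal].
move=> V1 V2 G n1 n2 n_gt0 rG b1c b2c b1u b2v.
have nR : 0 < n%:R :> R by rewrite ltr0n.
have n3 : #|'I_n| = n by rewrite card_ord.
set q := (n %/ L)%N.
have qL : (q * L)%:R <= n%:R :> R by rewrite ler_nat leq_divM.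
have qL' : n%:R <= q.+1%:R * L%:R :> R by rewrite -natrM ler_nat ltnW // ltn_ceil.
have jq : (j * q)%:R <= be * n%:R.
  apply: le_trans (ler_wpM2l (ltW be0) qL).
  rewrite !natrM [q%:R * _]mulrC mulrA; exact: ler_wpM2r.
have dn : d * n%:R <= q.+1%:R / 8.
  have dL' : d * L%:R <= 8^-1.
    by rewrite invfM in dL; rewrite -ler_pdivlMr.
  apply: le_trans (ler_wpM2l d0 qL') _.
  by rewrite mulrCA; apply: ler_wpM2l.
have q16 : 16 <= q.+1%:R :> R.
  by rewrite -[16]/(16%:R) ler_nat ltnW // ltnS leq_divRL // mulnC.
have aln : 2 * n%:R < al * n%:R ^+ 2.
  rewrite expr2 mulrA ltr_pM2r // mulrC -ltr_pdivrMr //.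
  by apply: lt_le_trans (truncnS_gt _) _; rewrite ler_nat.
(* One requirement for every exchange, and one for every absorption whose vertex of [V2] has large
   degree in the colour. *)
pose D : {set 'I_n * V2 + V1 * V2 * 'I_n} :=
  [set t | if t is inr s then big2 n G mu s.1.2 s.2 else true].
pose Q (t : 'I_n * V2 + V1 * V2 * 'I_n) := edge_triples G :&:
  match t with
  | inl s => exchangeable G (big2 n G mu) s.2 s.1
  | inr s => absorbing G s.1.1 s.1.2 s.2
  end.
have QG t e : t \in D -> e \in Q t -> e.1 \in G e.2.
  by move=> _; rewrite !inE => /andP[].
have n30 : 0 <= n%:R ^+ 3 :> R by apply: exprn_ge0.
have Qge t : t \in D -> th * n%:R ^+ 3 <= #|Q t|%:R.
  case: t => [[c v]|[[u b] c]]; rewrite inE /= => hD.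
    apply: le_trans (card_exchangeable n3 b1c b2c b2v _ _ _ _).
    - by apply: ler_wpM2r => //; rewrite /th; lra.
    - by apply: le_trans mube _; rewrite /be; lra.
    - by rewrite d0.
  apply: le_trans (card_absorbing b1u _ rG _ (ltW al0) hD).
    apply: ler_wpM2r => //; rewrite /th (_ : _ / 2 = g / 2 * al); last by field.
    by apply: ler_wpM2r; [exact: ltW|lra].
  by apply: le_trans mube _; rewrite /be; lra.
have cD : (#|D| < 2 ^ q)%N.
  apply: leq_ltn_trans (hN0 _ nN0); apply: leq_trans (max_card _) _.
  rewrite card_sum !card_prod card_ord n1 n2 mul2n -addnn !expnS expn0 muln1 mulnA.
  by rewrite leq_add2r leq_pmulr.
have [||F [mF Fle hits]] := exists_rich_matching n1 n2 n3 n_gt0 th0 QG Qge _ hj _ cD.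
- by rewrite /th; lra.
- have := ler_wpM2l (ltW gal0) (ltW nR); rewrite /th; move: jq; rewrite /be; lra.
have [M maxM] := exists_max_matching mF.
have [mM FM _] := maxM.
have Fbe : #|F|%:R <= be * n%:R by apply: le_trans jq; rewrite ler_nat.
have Mn : (#|M| <= n)%N by rewrite -(card_cov1 mM); have := max_card (cov1 M); rewrite n1.
have Mge : n%:R < #|M|%:R + d * n%:R + 4.
  apply: (max_matching_card n1 n2 n3 b1c b2c d0 rG _ _ aln maxM Fbe).
  - by rewrite /be in mube *; lra.
  - by rewrite ltr_pM2r //; rewrite /be in mube *; lra.
(* Fewer than [d n + 4] edges are missing, and both [d n <= (q + 1) / 8] and [4 <= (q + 1) / 4]. *)
have k2 : (2 * (n - #|M|) <= q.+1)%N.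
  by rewrite -(ler_nat R) natrM natrB //; lra.
have [|||||N [mN cN]] := @matching_absorb_all _ _ _ G (big2 n G mu) (n - #|M|) M F _ _ mM _ FM.
- by rewrite n1.
- by rewrite n1.
- by rewrite subnKC.
- move=> v c; apply: leq_trans k2 _.
  apply: leq_trans (hits (inl (c, v)) _) _; first by rewrite inE.
  by rewrite subset_leq_card // setIS // subsetIr.
- move=> u b c bc; apply: leq_trans k2 _.
  apply: leq_trans (hits (inr (u, b, c)) _) _; first by rewrite inE.
  by rewrite subset_leq_card // setIS // subsetIr.
by apply: has_transversal_perfect_matchingP mN _; rewrite ?cN.
Qed.

(** Brings the two kinds of stability to common parameters. *)
Lemma richnessW (R : realType) (V1 V2 C : finType) (n : nat)
    (G : C -> bigraph V1 V2) (g g' kap kap' : R) :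
  g' <= g -> kap' <= kap -> richness n G g kap kap -> richness n G g' kap' kap'.
Proof.
move=> gg kk rG A hA.
have wk (x : R) : (2^-1 - kap') * n%:R <= x -> (2^-1 - kap) * n%:R <= x.
  by apply: le_trans; apply: ler_wpM2r => //; lra.
apply: le_trans (ler_wpM2r (ler0n _ _) gg) _.
apply: le_trans (rG A (wk _ hA)) _.
rewrite ler_nat; apply: subset_leq_card; apply/subsetP => c; rewrite !inE.
move=> /forallP rc; apply/forallP => B; apply/implyP => hB.
have := rc B; rewrite (wk _ hB) /=; apply: le_trans.
by apply: ler_wpM2r => //; apply: exprn_ge0.
Qed.

(** Each relation of the hierarchy is an existential threshold depending on the constants to its
    right, introduced from right to left. *)
Theorem theorem2p10 (R : realType) :
  exists2 delta0 : R, 0 < delta0 &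
    forall delta : R, 0 < delta <= delta0 ->
  exists2 beta0 : R, 0 < beta0 &
    forall gamma eps : R, 0 < gamma <= beta0 -> 0 < eps <= beta0 ->
  exists2 alpha0 : R, 0 < alpha0 &
    forall alpha : R, 0 < alpha <= alpha0 ->
  exists2 mu0 : R, 0 < mu0 &
    forall mu : R, 0 < mu <= mu0 ->
  exists2 d0 : R, 0 < d0 &
    forall d : R, 0 < d <= d0 ->
  exists2 nu0 : R, 0 < nu0 &
    forall n : nat, 0 < (n%:R : R)^-1 <= nu0 ->
  forall (V1 V2 : finType) (G : 'I_n -> bigraph V1 V2)
         (P : 'I_n -> sextuple V1 V2),
    #|V1| = n -> #|V2| = n ->
    (forall i : 'I_n, extremal eps (G i) -> char_partition eps (G i) (P i)) ->
    stable gamma alpha eps delta G P ->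
    (forall i : 'I_n,
       #|[set x : V1 + V2 | (deg (G i) x)%:R < (2^-1 - mu) * n%:R]|%:R
         <= d * n%:R) ->
    (forall x : V1 + V2,
       #|[set i : 'I_n | (deg (G i) x)%:R < (2^-1 - mu) * n%:R]|%:R
         <= d * n%:R) ->
    has_transversal_perfect_matching G.
Proof.
exists 1 => // delta /andP[delta0 delta1].
(* This gives [60 * eps <= delta], used for crossing colours. *)
exists (delta / 60); first by lra.
move=> gamma eps /andP[gamma0 gammaB] /andP[eps0 epsB].
exists (Num.min eps 100^-1); first by rewrite lt_min eps0 /=; lra.
move=> alpha /andP[alpha0]; rewrite le_min => /andP[alphaE alpha1].
(* The proportion of rich colours is [gamma] under strong stability and [delta / 2] under weak
   stability. *)
have [||be be0 [d0 d00 [N core]]] :=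
    @transversal_of_richness R (Num.min gamma (delta / 2)) alpha.
- by rewrite lt_min gamma0 divr_gt0 //= ge_min; apply/orP; left; lra.
- by rewrite alpha0.
exists be => // mu /andP[_ mube]; exists d0 => // d /andP[d_gt0 dd0].
(* The second term ensures [1 <= eps * n], which absorbs the rounding of part sizes. *)
exists (maxn N (Num.truncn eps^-1)).+1%:R^-1; first by rewrite invr_gt0 ltr0n.
move=> n /andP[n0]; rewrite invr_gt0 in n0.
rewrite lef_pV2 ?posrE ?ltr0Sn // ler_nat gtn_max => /andP[nN neps].
move=> V1 V2 G P n1 n2 cp st degc degx.
have n_big : 1 <= eps * n%:R.
  rewrite mulrC -ler_pdivrMr // div1r; apply: ltW.
  by apply: lt_le_trans (truncnS_gt _) _; rewrite ler_nat.
apply: (core mu d n mube _ (ltnW nN) V1 V2 G n1 n2); first by rewrite ltW.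
- by rewrite ltr0n in n0.
- case: st => [st|st].
    by apply: richnessW (richness_strongly_stable n1 st); rewrite ?ge_min ?lexx.
  apply: richnessW (richness_weakly_stable n1 n2 eps0 delta1 _ n_big cp st).
  + by rewrite ge_min lexx orbT.
  + exact: alphaE.
  + lra.
- move=> c; apply: le_trans (degc c); rewrite ler_nat -(card_imset _ (@inl_inj V1 V2)).
  by apply: subset_leq_card; apply/subsetP => x /imsetP[u]; rewrite inE -ltNge => h ->;
     rewrite inE.
- move=> c; apply: le_trans (degc c); rewrite ler_nat -(card_imset _ (@inr_inj V1 V2)).
  by apply: subset_leq_card; apply/subsetP => x /imsetP[u]; rewrite inE -ltNge => h ->;
     rewrite inE.
- move=> u; apply: le_trans (degx (inl u)); rewrite ler_nat.
  by apply: subset_leq_card; apply/subsetP => c; rewrite !inE -ltNge.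
- move=> v; apply: le_trans (degx (inr v)); rewrite ler_nat.
  by apply: subset_leq_card; apply/subsetP => c; rewrite !inE -ltNge.
Qed.
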